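(* Let $\mathfrak g=\mathfrak k\oplus\mathfrak h$ be the Lie algebra attached to $(\pi,\alpha)$ (the extended semidirect product of $\mathfrak h$ and $\mathfrak k$ via $(\pi,\alpha)$), where $\mathfrak h$ is two-step nilpotent and $\dim\mathfrak h=\dim\mathfrak k$. Let $j\in C^1(\mathfrak k,\pi)$, i.e. $j:\mathfrak k\to\mathfrak h$ is a linear map. Then the endomorphism $J:\mathfrak g\to\mathfrak g$ given by $$J(x,y)=(-j^{-1}y,\,jx),\qquad x\in\mathfrak k,\ y\in\mathfrak h,$$ defines a complex structure on $\mathfrak g$ if and only if $j$ is a 1-cocycle of maximal rank and the 2-cocycle $\alpha$ satisfies $\alpha(x,y)=[jx,jy]_{\mathfrak h}$ for all $x,y\in\mathfrak k$.
   Context: Lie algebras are real and finite-dimensional. Let $(\mathfrak h,[\cdot,\cdot]_{\mathfrak h})$ and $(\mathfrak k,[\cdot,\cdot]_{\mathfrak k})$ be Lie algebras, $\pi$ a representation of $\mathfrak k$ on $\mathfrak h$ acting by derivations of $\mathfrak h$, and $\alpha:\mathfrak k\times\mathfrak k\to\mathfrak h$ a skew-symmetric bilinear map with image in the center $\mathfrak z(\mathfrak h)$ which is a 2-cocycle of $(\mathfrak k,\pi)$: $$\alpha([x,y]_{\mathfrak k},z)+\alpha([y,z]_{\mathfrak k},x)+\alpha([z,x]_{\mathfrak k},y)-\pi(z)\alpha(x,y)-\pi(x)\alpha(y,z)-\pi(y)\alpha(z,x)=0.$$ The extended semidirect product of $\mathfrak h$ and $\mathfrak k$ via $(\pi,\alpha)$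 is the Lie algebra $\mathfrak g=\mathfrak k\oplus\mathfrak h$ with bracket $[x,y]=[x,y]_{\mathfrak h}$ for $x,y\in\mathfrak h$; $[x,y]=\pi(x)y$ for $x\in\mathfrak k,y\in\mathfrak h$; $[x,y]=[x,y]_{\mathfrak k}+\alpha(x,y)$ for $x,y\in\mathfrak k$. A linear map $j:\mathfrak k\to\mathfrak h$ is a 1-cocycle of $(\mathfrak k,\pi)$ if $\pi(x)j(y)-\pi(y)j(x)-j([x,y]_{\mathfrak k})=0$ for all $x,y\in\mathfrak k$; it has maximal rank if it is invertible (which is what is needed for the formula for $J$ to make sense). A complex structure on $\mathfrak g$ is a linear map $J$ with $J^2=-1$ and $[Jx,Jy]=[x,y]+J[Jx,y]+J[x,Jy]$ for all $x,y\in\mathfrak g$. *)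

(* Defs.v *)
From HB Require Import structures.
From mathcomp Require Import all_boot all_order all_algebra.
From mathcomp Require Import sesquilinear reals lra.

Set Implicit Arguments.
Unset Strict Implicit.
Unset Printing Implicit Defensive.

Import GRing.Theory Num.Theory VectorInternalTheory.
Local Open Scope ring_scope.

HB.mixin Record Vector_isLieAlgebra (R : realType) L of Vector R L := {
  lie : L -> L -> L;
  lie_linearl : forall y, linear (lie ^~ y);
  lie_linearr : forall x, linear (lie x);
  liexx : forall x, lie x x = 0;
  lie_jacobi : forall x y z,
    lie x (lie y z) + lie y (lie z x) + lie z (lie x y) = 0
}.

#[short(type="lieAlgType")]
HB.structure Definition LieAlgebra (R : realType) :=
  {L of Vector R L & Vector_isLieAlgebra R L}.

Section LieTheory.
Variables (R : realType) (L : lieAlgType R).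
Implicit Types x y z : L.

Lemma lieDl x y z : lie (x + y) z = lie x z + lie y z.
Proof. by have := lie_linearl z 1 x y; rewrite /= !scale1r. Qed.

Lemma lieDr x y z : lie z (x + y) = lie z x + lie z y.
Proof. by have := lie_linearr z 1 x y; rewrite !scale1r. Qed.

Lemma lieC x y : lie x y = - lie y x.
Proof.
apply/eqP; rewrite -addr_eq0; apply/eqP; have := liexx (x + y).
by rewrite lieDl !lieDr !liexx add0r addr0.
Qed.

Lemma lier0 x : lie x 0 = 0.
Proof. by apply: (addrI (lie x 0)); rewrite -lieDr !addr0. Qed.

Lemma lierN x y : lie x (- y) = - lie x y.
Proof. by apply/eqP; rewrite -addr_eq0 -lieDr addNr lier0. Qed.

Definition central x := forall y, lie x y = 0.

(* Nilpotent of step at most two: abelian algebras are included. *)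
Definition two_step_nilpotent := forall x y z, lie x (lie y z) = 0.

Definition complex_structure (J : L -> L) :=
  [/\ linear J,
      forall x, J (J x) = - x
    & forall x y, lie (J x) (J y) = lie x y + J (lie (J x) y) + J (lie x (J y))].

End LieTheory.
Arguments two_step_nilpotent {R} L.

Section Representations.
Variables (R : realType) (k h : lieAlgType R).
Variable pi : {linear k -> 'End(h)}.

Definition representation :=
  forall x y u, pi (lie x y) u = pi x (pi y u) - pi y (pi x u).

Definition acts_by_derivations :=
  forall x u v, pi x (lie u v) = lie (pi x u) v + lie u (pi x v).

Definition cocycle1 (j : 'Hom(k, h)) :=
  forall x y, pi x (j y) - pi y (j x) - j (lie x y) = 0.

Definition cocycle2 (alpha : {bilinear k -> k -> h}) :=
  forall x y z,
    alpha (lie x y) z + alpha (lie y z) x + alpha (lie z x) y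
      - pi z (alpha x y) - pi x (alpha y z) - pi y (alpha z x) = 0.

End Representations.

Record ext_datum (R : realType) (k h : lieAlgType R) := ExtDatum {
  ext_pi : {linear k -> 'End(h)};
  ext_alpha : {bilinear k -> k -> h};
  ext_pi_rep : representation ext_pi;
  ext_pi_der : acts_by_derivations ext_pi;
  ext_alpha_skew : forall x y, ext_alpha x y = - ext_alpha y x;
  ext_alpha_central : forall x y, central (ext_alpha x y);
  ext_alpha_cocycle : cocycle2 ext_pi ext_alpha
}.

(* The Lie structure below depends on E, so the carrier has to mention E. *)
Definition ext_sdprod (R : realType) (k h : lieAlgType R) (E : ext_datum k h)
  : Type := (k * h)%type.

HB.instance Definition _ (R : realType) (k h : lieAlgType R)
    (E : ext_datum k h) := Vector.copy (ext_sdprod E) (k * h)%type.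

Section ExtendedSemidirectProduct.
Variables (R : realType) (k h : lieAlgType R) (E : ext_datum k h).
Local Notation pi := (ext_pi E).
Local Notation alpha := (ext_alpha E).
Local Notation g := (ext_sdprod E).

Definition ext_lie (p q : g) : g :=
  (lie p.1 q.1, lie p.2 q.2 + pi p.1 q.2 - pi q.1 p.2 + alpha p.1 q.1).

(* Linear identities in h are checked coordinatewise. *)
Let co i (u : h) : R := v2r u 0 i.

Let h_inj u v : (forall i, co i u = co i v) -> u = v.
Proof. by move=> uv; apply: (can_inj v2rK); apply/rowP. Qed.

Let h_coord u v i : u = v -> co i u = co i v.
Proof. by move->. Qed.

Let coD i u v : co i (u + v) = co i u + co i v.
Proof. by rewrite /co linearD mxE. Qed.
Let coN i u : co i (- u) = - co i u.
Proof. by rewrite /co linearN mxE. Qed.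
Let coZ i a u : co i (a *: u) = a * co i u.
Proof. by rewrite /co linearZ mxE. Qed.
Let co0 i : co i 0 = 0.
Proof. by rewrite /co linear0 mxE. Qed.
Let coE := (coD, coN, coZ, co0).

Let alpha_xx x : alpha x x = 0.
Proof.
apply: h_inj => i; have /(h_coord i) := ext_alpha_skew E x x.
rewrite !coE; lra.
Qed.

Lemma ext_liexx p : ext_lie p p = 0.
Proof. by rewrite /ext_lie !liexx alpha_xx add0r subrr addr0. Qed.

Lemma ext_lieC p q : ext_lie p q = - ext_lie q p.
Proof.
apply/pair_equal_spec; split => /=; first exact: lieC.
rewrite (lieC p.2) (ext_alpha_skew E p.1); apply: h_inj => i.
rewrite !coE; lra.
Qed.

Lemma ext_lie_linearr p : linear (ext_lie p).
Proof.
move=> a q q'; apply/pair_equal_spec; split => /=; first exact: lie_linearr.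
rewrite lie_linearr !linearP !lfunE /= !lfunE /=; apply: h_inj => i.
rewrite !coE; lra.
Qed.

Lemma ext_lie_linearl q : linear (ext_lie ^~ q).
Proof.
move=> a p p' /=; rewrite ext_lieC ext_lie_linearr (ext_lieC p) (ext_lieC p').
by rewrite opprD scalerN.
Qed.

Let central_lie u x y : lie u (alpha x y) = 0.
Proof. by rewrite lieC ext_alpha_central oppr0. Qed.

Lemma ext_lie_jacobi p q r :
  ext_lie p (ext_lie q r) + ext_lie q (ext_lie r p) + ext_lie r (ext_lie p q)
  = 0.
Proof.
apply/pair_equal_spec; split => /=; first exact: lie_jacobi.
case: p q r => [x u] [y v] [z w] /=.
rewrite !lieDr !lierN !central_lie !linearD !linearN /=.
rewrite !(ext_pi_rep E) !(ext_pi_der E).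
have J := lie_jacobi u v w; have C := ext_alpha_cocycle E x y z.
rewrite (ext_alpha_skew E x (lie _ _)) (ext_alpha_skew E y (lie _ _)).
rewrite (ext_alpha_skew E z (lie _ _)).
rewrite (lieC (pi x v)) (lieC (pi y w)) (lieC (pi z u)).
apply: h_inj => i; move: J C => /(h_coord i) J /(h_coord i) C.
move: J C; rewrite !coE; lra.
Qed.

HB.instance Definition _ := Vector_isLieAlgebra.Build R (ext_sdprod E)
  ext_lie_linearl ext_lie_linearr ext_liexx ext_lie_jacobi.

(* (j^-1)%VF is the library's total inverse of a linear map: the genuine
   inverse when j is bijective, and a linear map h -> k in all cases. *)
Definition ext_J (j : 'Hom(k, h)) (p : g) : g := (- (j^-1)%VF p.2, j p.1).

End ExtendedSemidirectProduct.
Arguments ext_J {R k h} E j p.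

(* Main.v *)
Require Import Defs.
From HB Require Import structures.
From mathcomp Require Import all_boot all_order all_algebra.
From mathcomp Require Import sesquilinear reals.

(** The obstruction to integrability of J is its Nijenhuis tensor
    N(p, q) = [Jp, Jq] - [p, q] - J[Jp, q] - J[p, Jq], and the point is that N
    only has to be computed on k x k.  The tensor is skew, and since J^2 = -1
    it is antilinear, N(Jp, q) = - J N(p, q) ([nijenhuisJl]); hence it vanishes
    everywhere as soon as it vanishes on a set S with g = S + JS
    ([nijenhuis_eq0_span]).  As J maps k onto h when j is invertible, S = k is
    such a set.

    On k x k, the mixed brackets [Jx, y] and [x, Jy] pair h with k, and
    [nijenhuis_ext_J] finds
      N(x, y) = (j^-1 (pi(x) j(y) - pi(y) j(x)) - [x, y],
                 [j(x), j(y)] - alpha(x, y)).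
    For invertible j the k-component vanishes exactly when j is a 1-cocycle,
    and the h-component exactly when alpha is the pullback of the bracket of h
    by j.  Finally J^2 = -1 says that j^-1 is a two-sided inverse of j. *)

Set Implicit Arguments.
Unset Strict Implicit.
Unset Printing Implicit Defensive.

Import GRing.Theory.
Local Open Scope ring_scope.

Lemma bijective_inv_lfun (F : fieldType) (V W : vectType F) (f : 'Hom(V, W)) :
  bijective f -> cancel f (f^-1)%VF /\ cancel (f^-1)%VF f.
Proof.
move=> bij_f; have fK : cancel f (f^-1)%VF.
  by apply/lker0_lfunK/lker0P/(bij_inj bij_f).
by split=> //; apply/(bij_can_sym bij_f).
Qed.

Section Nijenhuis.
Variables (R : realType) (L : lieAlgType R) (J : {linear L -> L}).

Definition nijenhuis x y :=
  lie (J x) (J y) - lie x y - J (lie (J x) y) - J (lie x (J y)).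

Lemma nijenhuis_eq0 x y : nijenhuis x y = 0 <->
  lie (J x) (J y) = lie x y + J (lie (J x) y) + J (lie x (J y)).
Proof.
rewrite /nijenhuis -!addrA -!opprD !addrA.
by split=> [/eqP|->]; [rewrite subr_eq0 => /eqP | exact: subrr].
Qed.

Lemma nijenhuisC x y : nijenhuis x y = - nijenhuis y x.
Proof.
rewrite /nijenhuis (lieC (J x) (J y)) (lieC x y) (lieC (J x) y) (lieC x (J y)).
by rewrite !linearN !opprD !opprK /= addrAC.
Qed.

Lemma nijenhuisDl x x' y :
  nijenhuis (x + x') y = nijenhuis x y + nijenhuis x' y.
Proof.
rewrite /nijenhuis linearD !lieDl !linearD /=.
by rewrite [RHS]addrACA; congr +%R; rewrite [RHS]addrACA; congr +%R;
   rewrite [RHS]addrACA.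
Qed.

Hypothesis JJ : forall x, J (J x) = - x.

Lemma nijenhuisJl x y : nijenhuis (J x) y = - J (nijenhuis x y).
Proof.
have lieNl u v : lie (- u) v = - lie u v by rewrite lieC lierN -lieC.
have JN u : J (- u) = - J u by exact: linearN.
have JD u v : J (u + v) = J u + J v by exact: linearD.
rewrite /nijenhuis JJ !lieNl !(JD, JN) !JJ !opprD !opprK.
by rewrite [RHS](ACl (4*3*2*1)).
Qed.

(** Additivity and antilinearity reduce the first variable to S, and skewness
    carries this reduction over to the second one. *)
Lemma nijenhuis_eq0_span (S : L -> Prop) :
  (forall x, exists a b, [/\ S a, S b & x = a + J b]) ->
  (forall a b, S a -> S b -> nijenhuis a b = 0) ->
  forall x y, nijenhuis x y = 0.
Proof.
move=> span NS.
have N0l y : (forall a, S a -> nijenhuis a y = 0) ->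
    forall x, nijenhuis x y = 0.
  move=> Ny x; have [a [b [Sa Sb ->]]] := span x.
  by rewrite nijenhuisDl nijenhuisJl !Ny // linear0 oppr0 addr0.
move=> x y; apply: (N0l) => a Sa; rewrite nijenhuisC N0l ?oppr0 // => b Sb.
exact: NS.
Qed.

End Nijenhuis.

Section ExtJ.
Variables (R : realType) (k h : lieAlgType R) (E : ext_datum k h).
Variable j : 'Hom(k, h).
Local Notation pi := (ext_pi E).
Local Notation alpha := (ext_alpha E).
Local Notation g := (ext_sdprod E).
Local Notation N := (nijenhuis (ext_J E j)).

Lemma ext_J_linear : linear (ext_J E j).
Proof.
move=> a p q; apply/pair_equal_spec; split => /=; last exact: linearP.
by rewrite linearP opprD scalerN.
Qed.

HB.instance Definition _ := GRing.isLinear.Build R g g *:%R (ext_J E j)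
  ext_J_linear.

Lemma ext_J_sqrN1 :
  (forall p, ext_J E j (ext_J E j p) = - p) <->
  cancel j (j^-1)%VF /\ cancel (j^-1)%VF j.
Proof.
split=> [JJ | [jK Kj] [x y]].
  split=> [x | y].
    by have [/oppr_inj] := JJ (x, 0).
  by have [_] := JJ (0, y); rewrite /= linearN => /oppr_inj.
by apply/pair_equal_spec; rewrite /= jK (linearN j) /= Kj.
Qed.

(** The bracket [Jx, Jy] is taken in h and [x, y] in k + h, where alpha appears;
    [Jx, y] = - pi(y) j(x) and [x, Jy] = pi(x) j(y) lie in h, so that J sends
    them to k through - j^-1. *)
Lemma nijenhuis_ext_J x y : N (x, 0) (y, 0) =
  ((j^-1)%VF (pi x (j y) - pi y (j x)) - lie x y,
   lie (j x) (j y) - alpha x y).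
Proof.
have alpha0l v : alpha 0 v = 0 by exact: linear0l.
have alpha0r u : alpha u 0 = 0 by exact: linear0r.
have lie0r (L : lieAlgType R) (u : L) : lie 0 u = 0 by rewrite lieC lier0 oppr0.
have lieE (p q : g) : lie p q = ext_lie p q by [].
rewrite /nijenhuis !lieE /ext_J /ext_lie /= linear0 oppr0.
rewrite !lie0r !lier0 !alpha0l !alpha0r.
apply/pair_equal_spec; split => /=.
  rewrite ?(linear0, lfunE, subr0, sub0r, add0r, addr0) /= !opprK.
  by rewrite -addrA -linearD addrC (addrC (- pi y _)).
by rewrite ?(linear0, lfunE, subr0, add0r, addr0).
Qed.

End ExtJ.

Theorem proposition3p6 (R : realType) (k h : lieAlgType R) (E : ext_datum k h)
    (h_nil : two_step_nilpotent h) (dim_hk : \dim {: h} = \dim {: k})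
    (j : 'Hom(k, h)) :
  complex_structure (ext_J E j) <->
  [/\ cocycle1 (ext_pi E) j, bijective j
    & forall x y : k, ext_alpha E x y = lie (j x) (j y)].
Proof.
split=> [[_ /ext_J_sqrN1[jK Kj] integrable] | [cj /bijective_inv_lfun[jK Kj] alphaE]].
  have Nk x y := (nijenhuis_eq0 _ _ _).2 (integrable (x, 0) (y, 0)).
  split; last 1 first.
  - move=> x y; have [_ /eqP] := etrans (esym (nijenhuis_ext_J E j x y)) (Nk x y).
    by rewrite subr_eq0 => /eqP.
  - move=> x y; have [/eqP + _] := etrans (esym (nijenhuis_ext_J E j x y)) (Nk x y).
    by rewrite subr_eq0 => /eqP <-; rewrite Kj subrr.
  - by exists (j^-1)%VF.
have JJ := (ext_J_sqrN1 E j).2 (conj jK Kj).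
split=> //; first exact: ext_J_linear.
move=> p q; apply/nijenhuis_eq0; move: p q.
apply: (nijenhuis_eq0_span JJ (S := fun p => p.2 = 0)) => [[x y] | [x u] [y v]].
  (* Any v in h is J (j^-1 v), with j^-1 v in k. *)
  exists (x, 0), ((j^-1)%VF y, 0); split=> //.
  by apply/pair_equal_spec; rewrite /= linear0 oppr0 addr0 Kj add0r.
move=> /= -> ->; rewrite nijenhuis_ext_J alphaE subrr.
by rewrite (subr0_eq (cj x y)) jK subrr.
Qed.
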